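(* Let $\mathsf{IL}_{\rm b} := \mathsf{ILL}+\mathsf{PRO}$ and let $A\mapsto A^{\dagger}$ be the translation of formulas of first-order intuitionistic logic $\mathsf{IL}$ into formulas of $\mathsf{ILL}$ defined in the context. Then for every formula $A$ of $\mathsf{IL}$: $\vdash_{\mathsf{IL}} A$ if and only if $\vdash_{\mathsf{IL}_{\rm b}} A^{\dagger}$.
   Context: Intuitionistic linear logic $\mathsf{ILL}$ (first order). Formulas are built from atomic formulas, including the constants $1,\top,0$, using $\otimes,\&,\oplus,\multimap$, $\forall x,\exists x$ and $!$. Sequents are $\Gamma\vdash A$ with $\Gamma$ a finite multiset of formulas and exactly one formula on the right. Axioms: $A\vdash A$; $\vdash 1$; $\Gamma\vdash\top$; $\Gamma,0\vdash C$. Rules (premises $\Rightarrow$ conclusion): (cut) $\Gamma\vdash A;\ \Delta,A\vdash C\Rightarrow\Gamma,\Delta\vdash C$; $\Gamma\vdash C\Rightarrow\Gamma,1\vdash C$; $\Gamma\vdash A;\ \Delta\vdash B\Rightarrow\Gamma,\Delta\vdash A\otimes B$; $\Gamma,A,B\vdash C\Rightarrow\Gamma,A\otimes B\vdash C$; $\Gamma,A\vdash B\Rightarrow\Gamma\vdash A\multimap B$; $\Gamma\vdash A;\ \Delta,B\vdash C\Rightarrow\Gamma,\Delta,A\multimap B\vdash C$; $\Gamma\vdash A;\ \Gamma\vdash B\Rightarrow\Gamma\vdash A\& B$; $\Gamma,A\vdash C\Rightarrow\Gamma,A\& B\vdash C$; $\Gamma,B\vdash C\Rightarrow\Gamma,A\&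 B\vdash C$; $\Gamma\vdash A\Rightarrow\Gamma\vdash A\oplus B$; $\Gamma\vdash B\Rightarrow\Gamma\vdash A\oplus B$; $\Gamma,A\vdash C;\ \Gamma,B\vdash C\Rightarrow\Gamma,A\oplus B\vdash C$; $\Gamma\vdash A\Rightarrow\Gamma\vdash\forall xA$; $\Gamma,A[t/x]\vdash C\Rightarrow\Gamma,\forall xA\vdash C$; $\Gamma\vdash A[t/x]\Rightarrow\Gamma\vdash\exists xA$; $\Gamma,A\vdash C\Rightarrow\Gamma,\exists xA\vdash C$ (usual eigenvariable conditions); $\Gamma,!A,!A\vdash C\Rightarrow\Gamma,!A\vdash C$; $\Gamma\vdash C\Rightarrow\Gamma,!A\vdash C$; $!\Gamma\vdash A\Rightarrow\,!\Gamma\vdash\,!A$; $\Gamma,A\vdash C\Rightarrow\Gamma,!A\vdash C$. $\mathsf{PRO}$ is the axiom schema $A\vdash\,!A$ (for all formulas $A$), and $\mathsf{ILL}+\mathsf{PRO}$ is $\mathsf{ILL}$ with these additional axioms. $\vdash_S A$ means that the sequent $\vdash A$ is derivable in $S$. $\mathsf{IL}$ is standard first-order intuitionistic logic with $\wedge,\vee,\to,\bot,\forall,\exists$. The translation $(\cdot)^\dagger$: $P^\dagger:=P$ for $P$ atomic other than $\bot$; $\bot^\dagger:=0$; $(A\wedge B)^\dagger:=A^\dagger\& B^\dagger$; $(A\vee B)^\dagger:=A^\dagger\oplus B^\dagger$; $(A\to B)^\dagger:=A^\dagger\multimap B^\dagger$; $(\forall xA)^\dagger:=\forall xA^\dagger$;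 $(\exists xA)^\dagger:=\exists xA^\dagger$. *)

(* Defs.v *)
(* Plain Stdlib.  Binding is de Bruijn: a quantifier binds index 0 of its body,
   and free indices are the free individual variables, so formulas may be open. *)
From Stdlib Require Import List Permutation.
From Stdlib Require Vector.
Import ListNotations.

Set Implicit Arguments.
Unset Strict Implicit.

Record signature : Type := Signature {
  funsym : Type;
  fun_arity : funsym -> nat;
  predsym : Type;
  pred_arity : predsym -> nat
}.

Section Syntax.
Variable L : signature.

Inductive term : Type :=
| Var (n : nat)
| Fun (f : funsym L) (ts : Vector.t term (fun_arity f)).

Fixpoint tsubst (s : nat -> term) (t : term) : term :=
  match t with
  | Var n => s n
  | Fun ts => Fun (Vector.map (tsubst s) ts)
  end.

Definition shift (n : nat) : term := Var (S n).

Definition up (s : nat -> term) (n : nat) : term :=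
  match n with
  | 0 => Var 0
  | S m => tsubst shift (s m)
  end.

Definition scons (t : term) (n : nat) : term :=
  match n with
  | 0 => t
  | S m => Var m
  end.

Inductive ilform : Type :=
| IAtom (P : predsym L) (ts : Vector.t term (pred_arity P))
| IBot
| IAnd (A B : ilform)
| IOr (A B : ilform)
| IImp (A B : ilform)
| IAll (A : ilform)
| IEx (A : ilform).

Fixpoint isubst (s : nat -> term) (A : ilform) : ilform :=
  match A with
  | IAtom ts => IAtom (Vector.map (tsubst s) ts)
  | IBot => IBot
  | IAnd A B => IAnd (isubst s A) (isubst s B)
  | IOr A B => IOr (isubst s A) (isubst s B)
  | IImp A B => IImp (isubst s A) (isubst s B)
  | IAll A => IAll (isubst (up s) A)
  | IEx A => IEx (isubst (up s) A)
  end.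

Inductive form : Type :=
| Atom (P : predsym L) (ts : Vector.t term (pred_arity P))
| One
| Top
| Zero
| Tensor (A B : form)
| With (A B : form)
| Plus (A B : form)
| Lolli (A B : form)
| All (A : form)
| Ex (A : form)
| Bang (A : form).

Fixpoint subst (s : nat -> term) (A : form) : form :=
  match A with
  | Atom ts => Atom (Vector.map (tsubst s) ts)
  | One => One
  | Top => Top
  | Zero => Zero
  | Tensor A B => Tensor (subst s A) (subst s B)
  | With A B => With (subst s A) (subst s B)
  | Plus A B => Plus (subst s A) (subst s B)
  | Lolli A B => Lolli (subst s A) (subst s B)
  | All A => All (subst (up s) A)
  | Ex A => Ex (subst (up s) A)
  | Bang A => Bang (subst s A)
  end.

End Syntax.

Arguments Var {L} n.
Arguments shift {L} n.
Arguments IBot {L}.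
Arguments One {L}.
Arguments Top {L}.
Arguments Zero {L}.

(* Natural deduction in sequent style.  In [nj_all_i] and [nj_ex_e] the
   eigenvariable is index 0, and shifting the other formulas is what makes it
   fresh for them. *)
Inductive NJ (L : signature) : list (ilform L) -> ilform L -> Prop :=
| nj_hyp G A : In A G -> NJ G A
| nj_bot_e G C : NJ G IBot -> NJ G C
| nj_and_i G A B : NJ G A -> NJ G B -> NJ G (IAnd A B)
| nj_and_e1 G A B : NJ G (IAnd A B) -> NJ G A
| nj_and_e2 G A B : NJ G (IAnd A B) -> NJ G B
| nj_or_i1 G A B : NJ G A -> NJ G (IOr A B)
| nj_or_i2 G A B : NJ G B -> NJ G (IOr A B)
| nj_or_e G A B C :
    NJ G (IOr A B) -> NJ (A :: G) C -> NJ (B :: G) C -> NJ G C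
| nj_imp_i G A B : NJ (A :: G) B -> NJ G (IImp A B)
| nj_imp_e G A B : NJ G (IImp A B) -> NJ G A -> NJ G B
| nj_all_i G A : NJ (map (isubst shift) G) A -> NJ G (IAll A)
| nj_all_e G A t : NJ G (IAll A) -> NJ G (isubst (scons t) A)
| nj_ex_i G A t : NJ G (isubst (scons t) A) -> NJ G (IEx A)
| nj_ex_e G A C :
    NJ G (IEx A) -> NJ (A :: map (isubst shift) G) (isubst shift C) -> NJ G C.

Definition IL_provable (L : signature) (A : ilform L) : Prop := NJ nil A.

(* ILL extended by a set [Ax] of additional axiom sequents.  Antecedents are
   lists, and [ill_exch] identifies lists representing the same multiset. *)
Inductive ILL (L : signature) (Ax : list (form L) -> form L -> Prop) :
  list (form L) -> form L -> Prop :=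
| ill_ax G A : Ax G A -> ILL Ax G A
| ill_exch G D C : Permutation G D -> ILL Ax G C -> ILL Ax D C
| ill_id A : ILL Ax [A] A
| ill_cut G D A C : ILL Ax G A -> ILL Ax (A :: D) C -> ILL Ax (G ++ D) C
| ill_one_r : ILL Ax nil One
| ill_one_l G C : ILL Ax G C -> ILL Ax (One :: G) C
| ill_top_r G : ILL Ax G Top
| ill_zero_l G C : ILL Ax (Zero :: G) C
| ill_tensor_r G D A B :
    ILL Ax G A -> ILL Ax D B -> ILL Ax (G ++ D) (Tensor A B)
| ill_tensor_l G A B C :
    ILL Ax (A :: B :: G) C -> ILL Ax (Tensor A B :: G) C
| ill_lolli_r G A B : ILL Ax (A :: G) B -> ILL Ax G (Lolli A B)
| ill_lolli_l G D A B C :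
    ILL Ax G A -> ILL Ax (B :: D) C -> ILL Ax (Lolli A B :: G ++ D) C
| ill_with_r G A B : ILL Ax G A -> ILL Ax G B -> ILL Ax G (With A B)
| ill_with_l1 G A B C : ILL Ax (A :: G) C -> ILL Ax (With A B :: G) C
| ill_with_l2 G A B C : ILL Ax (B :: G) C -> ILL Ax (With A B :: G) C
| ill_plus_r1 G A B : ILL Ax G A -> ILL Ax G (Plus A B)
| ill_plus_r2 G A B : ILL Ax G B -> ILL Ax G (Plus A B)
| ill_plus_l G A B C :
    ILL Ax (A :: G) C -> ILL Ax (B :: G) C -> ILL Ax (Plus A B :: G) C
| ill_all_r G A : ILL Ax (map (subst shift) G) A -> ILL Ax G (All A)
| ill_all_l G A t C :
    ILL Ax (subst (scons t) A :: G) C -> ILL Ax (All A :: G) C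
| ill_ex_r G A t : ILL Ax G (subst (scons t) A) -> ILL Ax G (Ex A)
| ill_ex_l G A C :
    ILL Ax (A :: map (subst shift) G) (subst shift C) -> ILL Ax (Ex A :: G) C
| ill_bang_c G A C :
    ILL Ax (Bang A :: Bang A :: G) C -> ILL Ax (Bang A :: G) C
| ill_bang_w G A C : ILL Ax G C -> ILL Ax (Bang A :: G) C
| ill_bang_r G A : ILL Ax (map (@Bang L) G) A -> ILL Ax (map (@Bang L) G) (Bang A)
| ill_bang_d G A C : ILL Ax (A :: G) C -> ILL Ax (Bang A :: G) C.

Inductive PRO (L : signature) : list (form L) -> form L -> Prop :=
| pro A : PRO [A] (Bang A).

Definition ILb_provable (L : signature) (A : form L) : Prop :=
  ILL (@PRO L) nil A.

Fixpoint dagger (L : signature) (A : ilform L) : form L :=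
  match A with
  | IAtom ts => Atom ts
  | IBot => Zero
  | IAnd A B => With (dagger A) (dagger B)
  | IOr A B => Plus (dagger A) (dagger B)
  | IImp A B => Lolli (dagger A) (dagger B)
  | IAll A => All (dagger A)
  | IEx A => Ex (dagger A)
  end.

(* Main.v *)
(* Under PRO every formula A is equivalent to !A, so contraction and weakening,
   which ILL grants to !A, hold for all formulas by cut against A |- !A; natural
   deduction can then be simulated rule by rule.  Conversely, erasing ! and
   collapsing the multiplicatives onto the intuitionistic connectives is sound
   for ILL + PRO, since A |- !A becomes A |- A, and it undoes the translation. *)
Require Import Defs.
From Stdlib Require Import List Permutation.
Import ListNotations.

Set Implicit Arguments.
Unset Strict Implicit.

Lemma subst_dagger (L : signature) (A : ilform L) (s : nat -> term L) :
  subst s (dagger A) = dagger (isubst s A).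
Proof. revert s; induction A; intro s; simpl; congruence. Qed.

Lemma map_subst_dagger (L : signature) (s : nat -> term L) (G : list (ilform L)) :
  map (subst s) (map (@dagger L) G) = map (@dagger L) (map (isubst s) G).
Proof. rewrite !map_map; apply map_ext; intro; apply subst_dagger. Qed.

Lemma ILL_PRO_contraction (L : signature) (G : list (form L)) (A C : form L) :
  ILL (@PRO L) (A :: A :: G) C -> ILL (@PRO L) (A :: G) C.
Proof.
  intro H.
  apply (@ill_cut _ _ [A] G (Bang A)); [apply ill_ax, pro|].
  apply ill_bang_c, ill_bang_d.
  eapply ill_exch; [apply perm_swap|].
  now apply ill_bang_d.
Qed.

Lemma ILL_PRO_weakening (L : signature) (G : list (form L)) (A C : form L) :
  ILL (@PRO L) G C -> ILL (@PRO L) (A :: G) C.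
Proof.
  intro H.
  apply (@ill_cut _ _ [A] G (Bang A)); [apply ill_ax, pro|].
  now apply ill_bang_w.
Qed.

(** Induction on [G]: its head also occurs in [D], so contraction removes it one formula at a
    time. *)
Lemma ILL_PRO_absorb (L : signature) (G D : list (form L)) (C : form L) :
  incl G D -> ILL (@PRO L) (G ++ D) C -> ILL (@PRO L) D C.
Proof.
  induction G as [|A G IH]; simpl; intros Hi H; [assumption|].
  apply incl_cons_inv in Hi as [HA Hi].
  apply IH; [assumption|].
  destruct (in_split A (G ++ D)) as (D1 & D2 & E).
  { apply in_or_app; now right. }
  rewrite E in *.
  (* The occurrence of [A] inside [G ++ D] is moved to the front, next to the copy to be
     contracted. *)
  eapply ill_exch; [apply Permutation_middle|].
  apply ILL_PRO_contraction.
  eapply ill_exch; [|exact H].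
  apply perm_skip, Permutation_sym, Permutation_middle.
Qed.

(** Weaken by all of [D], then absorb [G] into it. Antecedents thus behave as sets, like the
    contexts of [NJ]. *)
Lemma ILL_PRO_incl (L : signature) (G D : list (form L)) (C : form L) :
  incl G D -> ILL (@PRO L) G C -> ILL (@PRO L) D C.
Proof.
  intros Hi H.
  apply (ILL_PRO_absorb Hi).
  eapply ill_exch; [apply Permutation_app_comm|].
  clear Hi; induction D; simpl; [assumption|now apply ILL_PRO_weakening].
Qed.

(** Context-sharing form of cut: it turns a left rule of [ILL] into the matching elimination rule of
    [NJ]. *)
Lemma ILL_PRO_cut (L : signature) (G : list (form L)) (A C : form L) :
  ILL (@PRO L) G A -> ILL (@PRO L) (A :: G) C -> ILL (@PRO L) G C.
Proof.
  intros HA HC.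
  apply (@ILL_PRO_incl _ (G ++ G)); [apply incl_app; apply incl_refl|].
  exact (ill_cut HA HC).
Qed.

Lemma NJ_dagger (L : signature) (G : list (ilform L)) (A : ilform L) :
  NJ G A -> ILL (@PRO L) (map (@dagger L) G) (dagger A).
Proof.
  induction 1; simpl in *.
  - apply (@ILL_PRO_incl _ [dagger A]); [|apply ill_id].
    apply incl_cons; [now apply in_map|apply incl_nil_l].
  - eapply ILL_PRO_cut; [eassumption|apply ill_zero_l].
  - now apply ill_with_r.
  - eapply ILL_PRO_cut; [eassumption|].
    apply ill_with_l1, (@ILL_PRO_incl _ [dagger A]); [|apply ill_id].
    apply incl_cons; [now left|apply incl_nil_l].
  - eapply ILL_PRO_cut; [eassumption|].
    apply ill_with_l2, (@ILL_PRO_incl _ [dagger B]); [|apply ill_id].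
    apply incl_cons; [now left|apply incl_nil_l].
  - now apply ill_plus_r1.
  - now apply ill_plus_r2.
  - eapply ILL_PRO_cut; [eassumption|now apply ill_plus_l].
  - now apply ill_lolli_r.
  - eapply ILL_PRO_cut; [exact IHNJ1|].
    (* [ill_lolli_l] splits the context: all of it goes to the premise for [A], none to the identity
       on [B]. *)
    rewrite <- (app_nil_r (map _ G)).
    apply ill_lolli_l; [assumption|apply ill_id].
  - apply ill_all_r; now rewrite map_subst_dagger.
  - eapply ILL_PRO_cut; [eassumption|].
    apply (@ill_all_l _ _ _ _ t); rewrite subst_dagger.
    apply (@ILL_PRO_incl _ [dagger (isubst (scons t) A)]); [|apply ill_id].
    apply incl_cons; [now left|apply incl_nil_l].
  - apply (@ill_ex_r _ _ _ _ t); now rewrite subst_dagger.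
  - eapply ILL_PRO_cut; [eassumption|].
    apply ill_ex_l; now rewrite map_subst_dagger, subst_dagger.
Qed.

(** [IImp IBot IBot] plays the role of truth, which [ilform] lacks; it is provable and fixed by
    every substitution. *)
Fixpoint flat (L : signature) (A : form L) : ilform L :=
  match A with
  | Atom ts => IAtom ts
  | One | Top => IImp IBot IBot
  | Zero => IBot
  | Tensor A B | With A B => IAnd (flat A) (flat B)
  | Plus A B => IOr (flat A) (flat B)
  | Lolli A B => IImp (flat A) (flat B)
  | All A => IAll (flat A)
  | Ex A => IEx (flat A)
  | Bang A => flat A
  end.

Lemma flat_dagger (L : signature) (A : ilform L) : flat (dagger A) = A.
Proof. induction A; simpl; congruence. Qed.

Lemma flat_subst (L : signature) (A : form L) (s : nat -> term L) :
  flat (subst s A) = isubst s (flat A).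
Proof. revert s; induction A; intro s; simpl; congruence. Qed.

Lemma map_flat_subst (L : signature) (s : nat -> term L) (G : list (form L)) :
  map (@flat L) (map (subst s) G) = map (isubst s) (map (@flat L) G).
Proof. rewrite !map_map; apply map_ext; intro; apply flat_subst. Qed.

Lemma NJ_incl (L : signature) (G D : list (ilform L)) (A : ilform L) :
  incl G D -> NJ G A -> NJ D A.
Proof.
  intros Hi H; revert D Hi; induction H; intros D Hi.
  - now apply nj_hyp, Hi.
  - apply nj_bot_e; auto.
  - apply nj_and_i; auto.
  - eapply nj_and_e1; eauto.
  - eapply nj_and_e2; eauto.
  - apply nj_or_i1; auto.
  - apply nj_or_i2; auto.
  - apply (@nj_or_e _ _ A B); auto using incl_cons, in_eq, incl_tl.
  - apply nj_imp_i; auto using incl_cons, in_eq, incl_tl.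
  - eapply nj_imp_e; eauto.
  - apply nj_all_i; auto using incl_map.
  - apply nj_all_e; auto.
  - eapply nj_ex_i; eauto.
  - eapply nj_ex_e; eauto.
    apply IHNJ2, incl_cons; [apply in_eq|auto using incl_tl, incl_map].
Qed.

(** A detour through implication: discharge [A], weaken to [D], then eliminate. *)
Lemma NJ_cut (L : signature) (G D : list (ilform L)) (A C : ilform L) :
  NJ D A -> NJ (A :: G) C -> incl G D -> NJ D C.
Proof.
  intros HA HC Hi.
  apply (@nj_imp_e _ _ A); [|assumption].
  apply (NJ_incl Hi); now apply nj_imp_i.
Qed.

(** Most left rules become a cut on a component derived from the principal formula, which stays in
    the context. Promotion and dereliction leave the flattened sequent unchanged. *)
Lemma ILL_PRO_flat (L : signature) (G : list (form L)) (A : form L) :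
  ILL (@PRO L) G A -> NJ (map (@flat L) G) (flat A).
Proof.
  induction 1 as
    [ G A HA | G D C HP | A | G D A C | | G C | G | G C
    | G D A B | G A B C | G A B | G D A B C _ IHA _ IHC
    | G A B | G A B C | G A B C | G A B | G A B | G A B C _ IHA _ IHB
    | G A | G A t C | G A t | G A C | G A C | G A C | G A | G A C ];
    simpl in *; rewrite ?map_app in *.
  - destruct HA; apply nj_hyp; now left.
  - eapply NJ_incl; [|eassumption].
    intro; apply Permutation_in; now apply Permutation_map.
  - apply nj_hyp; now left.
  - eapply NJ_cut; [|eassumption|apply incl_appr, incl_refl].
    eapply NJ_incl; [apply incl_appl, incl_refl|assumption].
  - apply nj_imp_i, nj_hyp; now left.
  - eapply NJ_incl; [apply incl_tl, incl_refl|assumption].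
  - apply nj_imp_i, nj_hyp; now left.
  - apply nj_bot_e, nj_hyp; now left.
  - apply nj_and_i; (eapply NJ_incl; [|eassumption]);
      auto using incl_appl, incl_appr, incl_refl.
  (* Both components are needed at once, so two cuts are nested; cutting [flat B] first yields the
     order of the premise. *)
  - apply (@NJ_cut _ (IAnd (flat A) (flat B) :: map (@flat L) G) _ (flat B)).
    + eapply nj_and_e2, nj_hyp; now left.
    + apply (@NJ_cut _ (flat B :: map (@flat L) G) _ (flat A)).
      * eapply nj_and_e1, nj_hyp; right; now left.
      * assumption.
      * apply incl_cons; [apply in_eq|apply incl_tl, incl_tl, incl_refl].
    + apply incl_refl.
  - now apply nj_imp_i.
  - eapply NJ_cut; [|exact IHC|apply incl_tl, incl_appr, incl_refl].
    eapply nj_imp_e; [apply nj_hyp; now left|].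
    eapply NJ_incl; [apply incl_tl, incl_appl, incl_refl|assumption].
  - now apply nj_and_i.
  - eapply NJ_cut; [|eassumption|apply incl_tl, incl_refl].
    eapply nj_and_e1, nj_hyp; now left.
  - eapply NJ_cut; [|eassumption|apply incl_tl, incl_refl].
    eapply nj_and_e2, nj_hyp; now left.
  - now apply nj_or_i1.
  - now apply nj_or_i2.
  - eapply nj_or_e;
      [apply nj_hyp; now left|eapply NJ_incl, IHA|eapply NJ_incl, IHB];
      (apply incl_cons; [apply in_eq|apply incl_tl, incl_tl, incl_refl]).
  - apply nj_all_i; now rewrite <- map_flat_subst.
  - rewrite flat_subst in *.
    eapply NJ_cut; [|eassumption|apply incl_tl, incl_refl].
    apply nj_all_e, nj_hyp; now left.
  - rewrite flat_subst in *; eapply nj_ex_i; eassumption.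
  - rewrite flat_subst, map_flat_subst in *.
    eapply nj_ex_e; [apply nj_hyp; now left|].
    (* [nj_ex_e] retains the existential hypothesis, shifted, in its minor premise; weakening
       accounts for it. *)
    eapply NJ_incl; [|eassumption].
    apply incl_cons; [now left|apply incl_tl; simpl; apply incl_tl, incl_refl].
  - eapply NJ_incl; [|eassumption].
    auto using incl_cons, in_eq, incl_refl.
  - eapply NJ_incl; [apply incl_tl, incl_refl|assumption].
  - assumption.
  - assumption.
Qed.

Theorem proposition1 (L : signature) (A : ilform L) :
  IL_provable A <-> ILb_provable (dagger A).
Proof.
  split.
  - exact (@NJ_dagger L nil A).
  - intro H; apply ILL_PRO_flat in H; now rewrite flat_dagger in H.
Qed.
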